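(* The following five identities between real numbers hold: \begin{align*} \tan\left(\frac{\pi}{11}\right) + 4\sin\left(\frac{3\pi}{11}\right) &= \sqrt{11},\\ \tan\left(\frac{2\pi}{11}\right) - 4\sin\left(\frac{5\pi}{11}\right) &= -\sqrt{11},\\ \tan\left(\frac{3\pi}{11}\right) + 4\sin\left(\frac{2\pi}{11}\right) &= \sqrt{11},\\ \tan\left(\frac{4\pi}{11}\right) + 4\sin\left(\frac{\pi}{11}\right) &= \sqrt{11},\\ \tan\left(\frac{5\pi}{11}\right) - 4\sin\left(\frac{4\pi}{11}\right) &= \sqrt{11}. \end{align*}
   Context: Angles are in radians; $\sqrt{11}$ denotes the positive square root. *)

(* Defs.v *)
From Stdlib Require Import Reals.

(* Main.v *)
(** Put [t = k PI / 11] and [e = (-1)^(k+1)]; then [sin (6 t) = e sin (5 t)].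
    Dividing by [sin t] gives a quintic equation for [cos t], and modulo this
    quintic the square of [tan t + 4 e sin (3 t)] equals 11. For [k = 1..5] this
    quantity is the left-hand side of the [k]-th identity, so it only remains to
    determine its sign. *)
Require Import Defs.
From Stdlib Require Import Reals Lra.
Open Scope R_scope.

Lemma sin_3a (t : R) : sin (3 * t) = sin t * (4 * cos t ^ 2 - 1).
Proof.
  replace (3 * t) with (2 * t + t) by ring.
  rewrite sin_plus, sin_2a, cos_2a_cos. ring.
Qed.

Lemma cos_3a (t : R) : cos (3 * t) = 4 * cos t ^ 3 - 3 * cos t.
Proof.
  replace (3 * t) with (2 * t + t) by ring.
  rewrite cos_plus, sin_2a, cos_2a_cos.
  pose proof (sin2_cos2 t) as H. unfold Rsqr in H.
  replace (2 * sin t * cos t * sin t) with (2 * (sin t * sin t) * cos t) by ring.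
  replace (sin t * sin t) with (1 - cos t * cos t) by lra. ring.
Qed.

(** The factor after [sin t] is the Chebyshev polynomial U_4 at [cos t], and U_5 in [sin_6a]; once
    [sin t] cancels, only an equation in [cos t] is left. *)
Lemma sin_5a (t : R) :
  sin (5 * t) = sin t * (16 * cos t ^ 4 - 12 * cos t ^ 2 + 1).
Proof.
  replace (5 * t) with (3 * t + 2 * t) by ring.
  rewrite sin_plus, sin_3a, cos_3a, sin_2a, cos_2a_cos. ring.
Qed.

Lemma sin_6a (t : R) :
  sin (6 * t) = sin t * (32 * cos t ^ 5 - 32 * cos t ^ 3 + 6 * cos t).
Proof.
  replace (6 * t) with (2 * (3 * t)) by ring.
  rewrite sin_2a, sin_3a, cos_3a. ring.
Qed.

(** Keeping the sign [e] as a parameter lets one computation serve both parities of [k]. *)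
Lemma tan_4sin_sqr (e t : R) :
  e * e = 1 -> sin t <> 0 -> cos t <> 0 -> sin (6 * t) = e * sin (5 * t) ->
  Rsqr (tan t + 4 * e * sin (3 * t)) = 11.
Proof.
  intros He Hs Hc H.
  rewrite sin_5a, sin_6a in H. rewrite sin_3a. unfold tan, Rsqr.
  pose proof (sin2_cos2 t) as Hsc. unfold Rsqr in Hsc.
  set (s := sin t) in *. set (c := cos t) in *.
  (* Times [e * s], the left side is [e sin (5 t) - e^2 sin (6 t)], which vanishes by [He] and
     [H]. *)
  assert (Hq : 16 * c ^ 4 - 12 * c ^ 2 + 1
               - e * (32 * c ^ 5 - 32 * c ^ 3 + 6 * c) = 0).
  { apply (Rmult_eq_reg_l (e * s)).
    2:{ apply Rmult_integral_contrapositive_currified; [intros E | exact Hs].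
        rewrite E in He. lra. }
    replace (e * s * (16 * c ^ 4 - 12 * c ^ 2 + 1
                      - e * (32 * c ^ 5 - 32 * c ^ 3 + 6 * c)))
      with (e * (s * (16 * c ^ 4 - 12 * c ^ 2 + 1))
            - (e * e) * (s * (32 * c ^ 5 - 32 * c ^ 3 + 6 * c))) by ring.
    rewrite He, <- H. ring. }
  assert (He' : e = 1 \/ e = -1).
  { assert (Hf : (e - 1) * (e + 1) = 0) by (ring_simplify; lra).
    apply Rmult_integral in Hf. lra. }
  (* The left side is [c^2] times (square minus 11), with [s^2] written as [1 - c^2]. Since
     [e^2 = 1], it is a polynomial of degree 8 in [x = e c], and the cubic factor is its exact
     quotient by the quintic of [Hq]. *)
  assert (Hd : (1 - c * c) * (1 + 4 * e * c * (4 * c ^ 2 - 1)) ^ 2 - 11 * (c * c)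
               = (16 * c ^ 4 - 12 * c ^ 2 + 1
                  - e * (32 * c ^ 5 - 32 * c ^ 3 + 6 * c))
                 * (1 - 2 * e * c + 4 * c ^ 2 + 8 * e * c ^ 3)).
  { destruct He' as [-> | ->]; ring. }
  rewrite Hq, Rmult_0_l in Hd.
  replace (1 - c * c) with (s * s) in Hd by lra.
  apply (Rmult_eq_reg_r (c * c)).
  2:{ apply Rmult_integral_contrapositive_currified; exact Hc. }
  transitivity ((s * s) * (1 + 4 * e * c * (4 * c ^ 2 - 1)) ^ 2).
  - field. exact Hc.
  - lra.
Qed.

Lemma sqrt_Rsqr_eq (x y : R) : 0 <= x -> Rsqr x = y -> x = sqrt y.
Proof. intros Hx <-. symmetry. apply sqrt_Rsqr, Hx. Qed.

Lemma tan_4sin_sqr_acute (e t : R) :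
  e * e = 1 -> 0 < t < PI / 2 -> sin (6 * t) = e * sin (5 * t) ->
  Rsqr (tan t + 4 * e * sin (3 * t)) = 11.
Proof.
  intros He Ht H. apply tan_4sin_sqr; [exact He | | | exact H].
  - apply Rgt_not_eq, sin_gt_0; lra.
  - apply Rgt_not_eq, cos_gt_0; lra.
Qed.

Theorem theorem3p1 :
  tan (PI / 11) + 4 * sin (3 * PI / 11) = sqrt 11 /\
  tan (2 * PI / 11) - 4 * sin (5 * PI / 11) = - sqrt 11 /\
  tan (3 * PI / 11) + 4 * sin (2 * PI / 11) = sqrt 11 /\
  tan (4 * PI / 11) + 4 * sin (PI / 11) = sqrt 11 /\
  tan (5 * PI / 11) - 4 * sin (4 * PI / 11) = sqrt 11.
Proof.
  pose proof PI_RGT_0 as Hpi.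
  repeat split.
  - apply sqrt_Rsqr_eq.
    + assert (0 < tan (PI / 11)) by (apply tan_gt_0; lra).
      assert (0 < sin (3 * PI / 11)) by (apply sin_gt_0; lra).
      lra.
    + eapply eq_trans; [ | apply (tan_4sin_sqr_acute 1 (PI / 11)); [lra | lra | ]].
      * f_equal. replace (3 * (PI / 11)) with (3 * PI / 11) by field. ring.
      (* As [11 t = k PI], we have [6 t = k PI - 5 t]. Modulo [2 PI] this is [PI - 5 t] for odd [k]
         and [- 5 t] for even [k], which gives the sign [e] in each of the five cases. *)
      * rewrite <- (sin_PI_x (6 * (PI / 11))), Rmult_1_l. f_equal. field.
  (* The only negative case: the tangent is below 1, while the sine term exceeds 2. *)
  - rewrite <- (Ropp_involutive (_ - _)). f_equal. apply sqrt_Rsqr_eq.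
    + assert (tan (2 * PI / 11) < 1).
      { rewrite <- tan_PI4. apply tan_increasing; lra. }
      assert (1 / 2 < sin (5 * PI / 11)).
      { rewrite <- sin_PI6. apply sin_increasing_1; lra. }
      lra.
    + eapply eq_trans; [ | apply (tan_4sin_sqr_acute (-1) (2 * PI / 11)); [lra | lra | ]].
      * rewrite <- Rsqr_neg. f_equal. rewrite <- (sin_PI_x (5 * PI / 11)).
        replace (PI - 5 * PI / 11) with (3 * (2 * PI / 11)) by field. ring.
      * replace (6 * (2 * PI / 11)) with (- (5 * (2 * PI / 11)) + 2 * PI) by field.
        rewrite sin_plus, sin_2PI, cos_2PI, sin_neg. ring.
  - apply sqrt_Rsqr_eq.
    + assert (0 < tan (3 * PI / 11)) by (apply tan_gt_0; lra).
      assert (0 < sin (2 * PI / 11)) by (apply sin_gt_0; lra).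
      lra.
    + eapply eq_trans; [ | apply (tan_4sin_sqr_acute 1 (3 * PI / 11)); [lra | lra | ]].
      * f_equal. rewrite <- (sin_PI_x (2 * PI / 11)).
        replace (PI - 2 * PI / 11) with (3 * (3 * PI / 11)) by field. ring.
      * replace (6 * (3 * PI / 11)) with (PI - 5 * (3 * PI / 11) + 2 * PI) by field.
        rewrite sin_plus, sin_2PI, cos_2PI, sin_PI_x. ring.
  - apply sqrt_Rsqr_eq.
    + assert (0 < tan (4 * PI / 11)) by (apply tan_gt_0; lra).
      assert (0 < sin (PI / 11)) by (apply sin_gt_0; lra).
      lra.
    + eapply eq_trans; [ | apply (tan_4sin_sqr_acute (-1) (4 * PI / 11)); [lra | lra | ]].
      (* The shift by [PI] flips the sine, which cancels [e = -1]. *)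
      * f_equal. replace (3 * (4 * PI / 11)) with (PI / 11 + PI) by field.
        rewrite neg_sin. ring.
      * replace (6 * (4 * PI / 11)) with (- (5 * (4 * PI / 11)) + 2 * PI + 2 * PI)
          by field.
        rewrite !(sin_plus _ (2 * PI)), sin_2PI, cos_2PI, sin_neg. ring.
  - apply sqrt_Rsqr_eq.
    + (* [cos (5 PI / 11) = sin (PI / 22) < PI / 22 < 1 / 4], so
         [tan (5 PI / 11) > 4 sin (5 PI / 11) > 4 sin (4 PI / 11)]. *)
      assert (Hc : cos (5 * PI / 11) < 1 / 4).
      { rewrite <- sin_shift.
        apply Rlt_trans with (PI / 2 - 5 * PI / 11).
        - apply sin_lt_x. lra.
        - pose proof PI_4. lra. }
      assert (Hc0 : 0 < cos (5 * PI / 11)) by (apply cos_gt_0; lra).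
      assert (Hs : sin (4 * PI / 11) < sin (5 * PI / 11)).
      { apply sin_increasing_1; lra. }
      assert (Hs0 : 0 < sin (4 * PI / 11)) by (apply sin_gt_0; lra).
      unfold tan.
      enough (4 * sin (4 * PI / 11) <= sin (5 * PI / 11) / cos (5 * PI / 11)) by lra.
      apply (Rmult_le_reg_r (cos (5 * PI / 11))); [exact Hc0 | ].
      replace (sin (5 * PI / 11) / cos (5 * PI / 11) * cos (5 * PI / 11))
        with (sin (5 * PI / 11)) by (field; lra).
      pose proof (Rmult_lt_compat_l _ _ _ Hs0 Hc). lra.
    + eapply eq_trans; [ | apply (tan_4sin_sqr_acute 1 (5 * PI / 11)); [lra | lra | ]].
      (* The same shift with [e = 1] produces the minus sign of the identity. *)
      * f_equal. replace (3 * (5 * PI / 11)) with (4 * PI / 11 + PI) by field.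
        rewrite neg_sin. ring.
      * replace (6 * (5 * PI / 11)) with (PI - 5 * (5 * PI / 11) + 2 * PI + 2 * PI)
          by field.
        rewrite !(sin_plus _ (2 * PI)), sin_2PI, cos_2PI, sin_PI_x. ring.
Qed.
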